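(* If $M$ is a uniformly discrete pointed metric space, then $M$ is Lip-lin injective.
   Context: A metric space $(M,d)$ is uniformly discrete if there is $\theta>0$ such that $d(x,y)>\theta$ whenever $x\ne y$. A pointed metric space is a metric space with a distinguished base point $0$. $\mathrm{Lip}_0(M,N)$ is the set of Lipschitz maps $f\colon M\to N$ with $f(0)=0$; $\mathrm{Lip}_0(M)=\mathrm{Lip}_0(M,\mathbb R)$ is a Banach space for the norm $\|f\|_L$ = best Lipschitz constant of $f$. For $x\in M$, $\delta(x)\in \mathrm{Lip}_0(M)^*$ is the evaluation $\langle f,\delta(x)\rangle=f(x)$. The Lipschitz-free space $\mathcal F(M)$ is the norm-closed linear span of $\{\delta(x):x\in M\}$ in $\mathrm{Lip}_0(M)^*$. For $f\in \mathrm{Lip}_0(M,N)$, $\widehat f\colon \mathcal F(M)\to\mathcal F(N)$ is the unique bounded linear operator with $\widehat f(\delta(x))=\delta(f(x))$ for all $x\in M$. A complete pointed metric space $M$ is Lip-lin injective if for every complete pointed metric space $N$ and every injective $f\in \mathrm{Lip}_0(M,N)$, the operator $\widehat f$ is injective. *)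

(* Defs.v *)
From HB Require Import structures.
From mathcomp Require Import all_boot all_order all_algebra.
From mathcomp Require Import boolp classical_sets functions reals topology.
From mathcomp Require Import normedtype.

Set Implicit Arguments.
Unset Strict Implicit.
Unset Printing Implicit Defensive.

Import Order.TTheory GRing.Theory Num.Theory.
Import numFieldNormedType.Exports.

Local Open Scope classical_set_scope.
Local Open Scope ring_scope.

#[short(type="pointedMetricType")]
HB.structure Definition PointedMetric (R : numDomainType) :=
  { M of Metric R M & isPointed M }.

(* Over [R^o] the library's base point is [0] and its distance is [`|y - x|]. *)
HB.instance Definition _ (R : realType) := Pointed.on R^o.

(* The axiom [cauchy_cvg] of [completeType], as a predicate. *)
Definition complete_space (T : uniformType) : Prop :=
  forall F : set_system T, ProperFilter F -> cauchy F -> exists l : T, F --> l.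

Definition uniformly_discrete (R : realType) (M : metricType R) : Prop :=
  exists2 theta : R, 0 < theta & forall x y : M, x <> y -> theta < mdist x y.

(* Requiring [0 <= C] matters only for the degenerate domains (one point, or
   the zero space), where every real would otherwise be admissible. *)
Definition best_const (R : realType) (P : R -> Prop) : R :=
  inf [set C | 0 <= C /\ P C].

Section BestConst.
Context {R : realType} {I : Type} (P : R -> Prop) (a w : I -> R).
Hypothesis w0 : forall i, 0 <= w i.
Hypothesis PE : forall C, P C <-> forall i, a i <= C * w i.

Lemma best_const_ge0 : 0 <= best_const P.
Proof.
rewrite /best_const; have [->|/set0P[C CP]] := eqVneq [set C | 0 <= C /\ P C] set0.
  by rewrite inf0.
by apply: lb_le_inf; [exists C|move=> D []].
Qed.

Lemma best_const_le C : 0 <= C -> P C -> best_const P <= C.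
Proof. by move=> C0 PC; apply: ge_inf => //; exists 0 => D []. Qed.

Lemma best_constP : (exists C, P C) -> P (best_const P).
Proof.
move=> [C /PE PC]; apply/PE => i.
have hi : has_inf [set C | 0 <= C /\ P C].
  split; last by exists 0 => D [].
  exists `|C|; split; first exact: normr_ge0.
  by apply/PE => j; rewrite (le_trans (PC j))// ler_wpM2r// ler_norm.
have [wi0|wi0] := eqVneq (w i) 0.
  by rewrite wi0 mulr0; have := PC i; rewrite wi0 mulr0.
have wi : 0 < w i by rewrite lt_neqAle eq_sym wi0 w0.
rewrite -ler_pdivrMr//; apply/ler_addgt0Pr => e e0.
have [D [D0 /PE PD] Db] := inf_adherent e0 hi.
by rewrite ler_pdivrMr// (le_trans (PD i))// ler_wpM2r// ltW.
Qed.

End BestConst.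

Section Lip0.
Context {R : realType}.
Implicit Types M N : pointedMetricType R.

Definition lipschitz_with M N (C : R) (f : M -> N) : Prop :=
  forall x y, mdist (f x) (f y) <= C * mdist x y.

Definition lip0_pred M N : {pred M -> N} :=
  fun f => `[< f point = point /\ exists C, lipschitz_with C f >].

Record lip0 M N := Lip0 { lip0_fun :> M -> N ; _ : lip0_fun \in @lip0_pred M N }.

HB.instance Definition _ M N := [isSub for @lip0_fun M N].
HB.instance Definition _ M N := [Choice of lip0 M N by <:].

Lemma lip0P M N (f : lip0 M N) : f point = point /\ exists C, lipschitz_with C f.
Proof. by case: f => f /= /asboolP. Qed.

End Lip0.
Arguments lip0_pred {R} M N.

Section Lip0Real.
Context {R : realType} (M : pointedMetricType R).

Let rlipP (f : M -> R^o) :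
  reflect (f point = 0 /\ exists C, forall x y, `|f x - f y| <= C * mdist x y)
          (f \in lip0_pred M R^o).
Proof.
apply: (iffP idP) => [/asboolP[f0 [C fC]]|[f0 [C fC]]].
  by split=> //; exists C => x y; rewrite distrC; exact: fC.
by apply/asboolP; split=> //; exists C => x y; rewrite /mdist/= distrC; exact: fC.
Qed.

Fact lip0_submod : submod_closed (lip0_pred M R^o).
Proof.
split.
  apply/rlipP; split=> //; exists 0 => x y.
  by rewrite mul0r subrr normr0.
move=> a f g /rlipP[f0 [C fC]] /rlipP[g0 [D gD]]; apply/rlipP; split.
  by rewrite !fctE f0 g0 scaler0 addr0.
exists (`|a| * C + D) => x y; rewrite !fctE opprD addrACA -scalerBr.
rewrite (le_trans (ler_normD _ _))// mulrDl lerD// normrZ -mulrA.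
by rewrite ler_wpM2l.
Qed.

HB.instance Definition _ := GRing.isSubmodClosed.Build R (M -> R^o)
  (lip0_pred M R^o) lip0_submod.
HB.instance Definition _ := [SubChoice_isSubLmodule of lip0 M R^o by <:].

Definition lip_norm (f : lip0 M R^o) : R :=
  best_const (fun C => lipschitz_with C f).

Lemma lip_normP (f : lip0 M R^o) x y : `|f x - f y| <= lip_norm f * mdist x y.
Proof.
have [_ [C fC]] := lip0P f; rewrite distrC.
suff /(_ x y) : lipschitz_with (lip_norm f) f by [].
apply: (@best_constP _ _ (fun C => lipschitz_with C f) (fun p => mdist (f p.1) (f p.2))
    (fun p => mdist p.1 p.2)); last by exists C.
- by move=> p; exact: mdist_ge0.
- by move=> D; split=> [fD p|fD u v]; [exact: fD|exact: (fD (u, v))].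
Qed.

Lemma lip_norm_ge0 (f : lip0 M R^o) : 0 <= lip_norm f.
Proof. exact: best_const_ge0. Qed.

Lemma lip_norm_le (f : lip0 M R^o) C : 0 <= C ->
  (forall x y, `|f x - f y| <= C * mdist x y) -> lip_norm f <= C.
Proof.
by move=> C0 fC; apply: best_const_le => // x y; rewrite /mdist/= distrC; exact: fC.
Qed.

Let lip_normD (f g : lip0 M R^o) : lip_norm (f + g) <= lip_norm f + lip_norm g.
Proof.
apply: lip_norm_le => [|x y]; first by rewrite addr_ge0// lip_norm_ge0.
rewrite [(f + g) x]/(f x + g x) [(f + g) y]/(f y + g y) opprD addrACA.
by rewrite (le_trans (ler_normD _ _))// mulrDl lerD// lip_normP.
Qed.

Let lip_normZ_le a (f : lip0 M R^o) : lip_norm (a *: f) <= `|a| * lip_norm f.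
Proof.
apply: lip_norm_le => [|x y]; first by rewrite mulr_ge0// lip_norm_ge0.
rewrite [(a *: f) x]/(a *: f x) [(a *: f) y]/(a *: f y) -scalerBr normrZ -mulrA.
by rewrite ler_wpM2l// lip_normP.
Qed.

Let lip_normZ a (f : lip0 M R^o) : lip_norm (a *: f) = `|a| * lip_norm f.
Proof.
apply/eqP; rewrite eq_le lip_normZ_le/=.
have [->|a0] := eqVneq a 0; first by rewrite normr0 mul0r lip_norm_ge0.
rewrite -ler_pdivlMl ?normr_gt0// -normfV -{1}[f](scalerK a0).
exact: lip_normZ_le.
Qed.

Let lip_norm_eq0 (f : lip0 M R^o) : lip_norm f = 0 -> f = 0.
Proof.
move=> f0; apply/val_inj/funext => x /=; apply/eqP.
have [fp _] := lip0P f.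
have := lip_normP f x point; rewrite f0 mul0r normr_le0 fp.
by rewrite [point]/(0 : R^o) subr0.
Qed.

HB.instance Definition _ := Lmodule_isNormed.Build R (lip0 M R^o)
  lip_normD lip_normZ lip_norm_eq0.

Lemma lip0_normE (f : lip0 M R^o) : `|f| = lip_norm f.
Proof. by []. Qed.

End Lip0Real.

Section Dual.
Context {R : realType} (V : normedModType R).

Definition bounded_with (W : normedModType R) (C : R) (T : V -> W) : Prop :=
  forall v, `|T v| <= C * `|v|.

Definition bounded_linear_op (W : normedModType R) (T : V -> W) : Prop :=
  linear T /\ exists C, bounded_with C T.

Definition dual_pred : {pred V -> R^o} := fun phi => `[< bounded_linear_op phi >].

Record dual := Dual { dual_fun :> V -> R^o ; _ : dual_fun \in dual_pred }.

HB.instance Definition _ := [isSub for dual_fun].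
HB.instance Definition _ := [Choice of dual by <:].

Lemma dualP (phi : dual) : bounded_linear_op phi.
Proof. by case: phi => phi /= /asboolP. Qed.

HB.instance Definition _ (phi : dual) := GRing.isLinear.Build R V R^o _ phi
  (dualP phi).1.

Fact dual_submod : submod_closed dual_pred.
Proof.
split.
  apply/asboolP; split=> [a u v|]; first by rewrite /= scaler0 addr0.
  by exists 0 => v; rewrite normr0 mul0r.
move=> a f g /asboolP[fl [C fC]] /asboolP[gl [D gD]]; apply/asboolP; split.
  move=> b u v; rewrite !fctE fl gl !scalerDr addrACA; congr (_ + _ + _ ).
  by rewrite !scalerA mulrC.
exists (`|a| * C + D) => v; rewrite !fctE.
rewrite (le_trans (ler_normD _ _))// mulrDl lerD// normrZ -mulrA.
by rewrite ler_wpM2l.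
Qed.

HB.instance Definition _ := GRing.isSubmodClosed.Build R (V -> R^o)
  dual_pred dual_submod.
HB.instance Definition _ := [SubChoice_isSubLmodule of dual by <:].

Definition dual_norm (phi : dual) : R :=
  best_const (fun C => bounded_with C phi).

Lemma dual_normP (phi : dual) v : `|phi v| <= dual_norm phi * `|v|.
Proof.
have [_ [C fC]] := dualP phi.
suff /(_ v) : bounded_with (dual_norm phi) phi by [].
apply: (@best_constP _ _ (fun C => bounded_with C phi) (fun v => `|phi v|) (fun v => `|v|)) => //.
by exists C.
Qed.

Lemma dual_norm_ge0 (phi : dual) : 0 <= dual_norm phi.
Proof. exact: best_const_ge0. Qed.

Lemma dual_norm_le (phi : dual) C : 0 <= C ->
  (forall v, `|phi v| <= C * `|v|) -> dual_norm phi <= C.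
Proof. by move=> C0 fC; apply: best_const_le. Qed.

Let dual_normD (f g : dual) : dual_norm (f + g) <= dual_norm f + dual_norm g.
Proof.
apply: dual_norm_le => [|x]; first by rewrite addr_ge0// dual_norm_ge0.
rewrite [(f + g) x]/(f x + g x).
by rewrite (le_trans (ler_normD _ _))// mulrDl lerD// dual_normP.
Qed.

Let dual_normZ_le a (f : dual) : dual_norm (a *: f) <= `|a| * dual_norm f.
Proof.
apply: dual_norm_le => [|x]; first by rewrite mulr_ge0// dual_norm_ge0.
by rewrite [(a *: f) x]/(a *: f x) normrZ -mulrA ler_wpM2l// dual_normP.
Qed.

Let dual_normZ a (f : dual) : dual_norm (a *: f) = `|a| * dual_norm f.
Proof.
apply/eqP; rewrite eq_le dual_normZ_le/=.
have [->|a0] := eqVneq a 0; first by rewrite normr0 mul0r dual_norm_ge0.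
rewrite -ler_pdivlMl ?normr_gt0// -normfV -{1}[f](scalerK a0).
exact: dual_normZ_le.
Qed.

Let dual_norm_eq0 (f : dual) : dual_norm f = 0 -> f = 0.
Proof.
move=> f0; apply/val_inj/funext => x /=; apply/eqP.
by have := dual_normP f x; rewrite f0 mul0r normr_le0.
Qed.

HB.instance Definition _ := Lmodule_isNormed.Build R dual
  dual_normD dual_normZ dual_norm_eq0.

Lemma dual_normE (phi : dual) : `|phi| = dual_norm phi.
Proof. by []. Qed.

End Dual.
Arguments dual_pred {R} V.

Section LipFree.
Context {R : realType} (M : pointedMetricType R).

Definition evaluation (x : M) : lip0 M R^o -> R^o := fun f => f x.

Fact evaluation_dual x : evaluation x \in dual_pred (lip0 M R^o).
Proof.
apply/asboolP; split=> [//|]; exists (mdist x point) => f.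
have [fp _] := lip0P f; have := lip_normP f x point.
by rewrite fp [point]/(0 : R^o) subr0 mulrC.
Qed.

Definition delta (x : M) : dual (lip0 M R^o) := Dual (evaluation_dual x).

Definition delta_span : set (dual (lip0 M R^o)) :=
  range (fun s : seq (R * M) => \sum_(p <- s) p.1 *: delta p.2).

Definition lip_free_pred : {pred dual (lip0 M R^o)} :=
  fun phi => `[< closure delta_span phi >].

Record lip_free := LipFree
  { lip_free_val :> dual (lip0 M R^o) ; _ : lip_free_val \in lip_free_pred }.

HB.instance Definition _ := [isSub for lip_free_val].
HB.instance Definition _ := [Choice of lip_free by <:].

Lemma lip_freeP (mu : lip_free) : closure delta_span (lip_free_val mu).
Proof. by case: mu => mu /= /asboolP. Qed.

Lemma closure_delta_spanP (phi : dual (lip0 M R^o)) :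
  closure delta_span phi <->
  forall e : R, 0 < e -> exists2 psi, delta_span psi & `|phi - psi| < e.
Proof.
split=> [cl e e0|H B /nbhs_ballP[e /= e0 Be]].
  have [psi [Spsi]] := cl _ (nbhsx_ballx phi e e0).
  by rewrite -ball_normE /=; exists psi.
by have [psi Spsi pe] := H e e0; exists psi; split=> //; apply: Be; rewrite -ball_normE.
Qed.

Lemma delta_spanD a f g :
  delta_span f -> delta_span g -> delta_span (a *: f + g).
Proof.
move=> [s _ <-] [t _ <-]; exists ([seq (a * p.1, p.2) | p <- s] ++ t) => //.
rewrite big_cat big_map /= scaler_sumr; congr (_ + _).
by apply: eq_bigr => p _; rewrite scalerA.
Qed.

Fact lip_free_submod : submod_closed lip_free_pred.
Proof.
split.
  apply/asboolP/subset_closure; exists [::] => //.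
  by rewrite big_nil.
move=> a f g /asboolP/closure_delta_spanP Sf /asboolP/closure_delta_spanP Sg.
apply/asboolP/closure_delta_spanP => e e0.
have e2 : 0 < e / 2 by rewrite divr_gt0.
have a1 : 0 < `|a| + 1 by rewrite ltr_wpDl.
have [f' Sf' ff'] := Sf (e / 2 / (`|a| + 1)) (divr_gt0 e2 a1).
have [g' Sg' gg'] := Sg (e / 2) e2.
exists (a *: f' + g'); first exact: delta_spanD.
rewrite opprD addrACA -scalerBr (le_lt_trans (ler_normD _ _))// (splitr e).
apply: ler_ltD => //; rewrite normrZ.
move: ff'; rewrite ltr_pdivlMr// => /ltW; apply: le_trans.
by rewrite mulrC ler_wpM2l// lerDl.
Qed.

HB.instance Definition _ := GRing.isSubmodClosed.Build R (dual (lip0 M R^o))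
  lip_free_pred lip_free_submod.
HB.instance Definition _ := [SubChoice_isSubLmodule of lip_free by <:].

Definition lip_free_norm (mu : lip_free) : R := `|lip_free_val mu|.

Let lip_free_normD mu nu :
  lip_free_norm (mu + nu) <= lip_free_norm mu + lip_free_norm nu.
Proof. exact: ler_normD. Qed.

Let lip_free_normZ a mu : lip_free_norm (a *: mu) = `|a| * lip_free_norm mu.
Proof. exact: normrZ. Qed.

Let lip_free_norm_eq0 mu : lip_free_norm mu = 0 -> mu = 0.
Proof. by move=> /normr0_eq0 h; exact: val_inj. Qed.

HB.instance Definition _ := Lmodule_isNormed.Build R lip_free
  lip_free_normD lip_free_normZ lip_free_norm_eq0.

Lemma lip_free_normE (mu : lip_free) : `|mu| = `|lip_free_val mu|.
Proof. by []. Qed.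

Fact delta_lip_free x : delta x \in lip_free_pred.
Proof.
apply/asboolP/subset_closure; exists [:: (1, x)] => //.
by rewrite big_seq1 scale1r.
Qed.

Definition free_delta (x : M) : lip_free := LipFree (delta_lip_free x).

End LipFree.
Arguments lip_free_pred {R} M.
Arguments lip_freeP {R M} mu.

Section Linearization.
Context {R : realType} {M N : pointedMetricType R} (f : lip0 M N).

Definition is_linearization (T : lip_free M -> lip_free N) : Prop :=
  bounded_linear_op T /\ forall x, T (free_delta x) = free_delta (f x).

Let precomp_lip0 (g : lip0 N R^o) : (g \o f : M -> R^o) \in lip0_pred M R^o.
Proof.
have [fp [C fC]] := lip0P f; have [gp _] := lip0P g.
apply/asboolP; split; first by rewrite /= fp.
exists (lip_norm g * C) => x y; rewrite {1}/mdist/= distrC -mulrA.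
by rewrite (le_trans (lip_normP g _ _))// ler_wpM2l// lip_norm_ge0.
Qed.

Let precomp g : lip0 M R^o := Lip0 (precomp_lip0 g).

Let precomp_le : exists2 C, 0 <= C & forall g, `|precomp g| <= C * `|g|.
Proof.
have [_ [C fC]] := lip0P f.
exists `|C| => // g; apply: lip_norm_le => [|x y]; first by rewrite mulr_ge0.
rewrite (le_trans (lip_normP g _ _))// lip0_normE [`|C| * _]mulrC -mulrA.
by rewrite ler_wpM2l ?lip_norm_ge0// (le_trans (fC x y))// ler_wpM2r ?mdist_ge0// ler_norm.
Qed.

Let pushforward_dual (phi : dual (lip0 M R^o)) :
  (phi \o precomp : lip0 N R^o -> R^o) \in dual_pred (lip0 N R^o).
Proof.
have [C C0 pC] := precomp_le.
apply/asboolP; split=> [a g h /=|].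
  have -> : precomp (a *: g + h) = a *: precomp g + precomp h by exact: val_inj.
  exact: linearP.
exists (`|phi| * C) => g /=; rewrite (le_trans (dual_normP _ _))//.
by rewrite -mulrA; apply: ler_wpM2l => //; exact: dual_norm_ge0.
Qed.

Let pushforward phi : dual (lip0 N R^o) := Dual (pushforward_dual phi).

Let pushforwardP a phi psi :
  pushforward (a *: phi + psi) = a *: pushforward phi + pushforward psi.
Proof. exact: val_inj. Qed.

Let pushforward_le : exists2 C, 0 <= C &
  forall phi, `|pushforward phi| <= C * `|phi|.
Proof.
have [C C0 pC] := precomp_le; exists C => // phi.
apply: dual_norm_le => [|g]; first by rewrite mulr_ge0.
apply: (le_trans (dual_normP phi (precomp g))).
have -> : C * `|phi| * `|g| = dual_norm phi * (C * `|g|) by rewrite mulrCA mulrA.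
by apply: ler_wpM2l => //; exact: dual_norm_ge0.
Qed.

Let pushforward_free (mu : lip_free M) :
  pushforward (lip_free_val mu) \in lip_free_pred N.
Proof.
have pf0 : pushforward 0 = 0 by exact: val_inj.
have [C C0 pC] := pushforward_le.
have C1 : 0 < C + 1 by rewrite ltr_wpDl.
apply/asboolP/closure_delta_spanP => e e0.
have /closure_delta_spanP/(_ _ (divr_gt0 e0 C1))[_ [s _ <-] se] := lip_freeP mu.
exists (pushforward (\sum_(p <- s) p.1 *: delta p.2)).
  exists [seq (p.1, f p.2) | p <- s] => //; rewrite big_map /=.
  elim: s {se} => [|p s IH]; first by rewrite !big_nil.
  by rewrite !big_cons IH pushforwardP; congr (_ *: _ + _); exact: val_inj.
rewrite -scaleN1r addrC -pushforwardP addrC scaleN1r.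
rewrite (le_lt_trans (pC _))//; move: se; rewrite ltr_pdivlMr//.
by apply: le_lt_trans; rewrite mulrC ler_wpM2l// lerDl.
Qed.

Lemma linearization_exists : exists T, is_linearization T.
Proof.
exists (fun mu => LipFree (pushforward_free mu)); split; last first.
  by move=> x; do 2 apply: val_inj.
split=> [a mu nu|]; first by apply: val_inj; exact: pushforwardP.
by have [C _ pC] := pushforward_le; exists C => mu; exact: pC.
Qed.

Lemma linearization_unique T T' :
  is_linearization T -> is_linearization T' -> T = T'.
Proof.
move=> [[Tl [C TC]] Td] [[Tl' [C' TC']] Td']; apply/funext => mu.
pose S mu := T mu - T' mu.
have SP a u v : S (a *: u + v) = a *: S u + S v.
  by rewrite /S Tl Tl' scalerBr opprD addrACA.
have S0 : S 0 = 0.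
  by have := SP (-1) 0 0; rewrite scaler0 addr0 scaleN1r addNr.
have SC u : `|S u| <= (`|C| + `|C'|) * `|u|.
  rewrite (le_trans (ler_normB _ _))// mulrDl lerD//.
    by rewrite (le_trans (TC u))// ler_wpM2r// ler_norm.
  by rewrite (le_trans (TC' u))// ler_wpM2r// ler_norm.
have Ssum (s : seq (R * M)) : S (\sum_(p <- s) p.1 *: free_delta p.2) = 0.
  elim: s => [|p s IH]; first by rewrite big_nil.
  by rewrite big_cons SP IH /S Td Td' subrr scaler0 addr0.
set D := `|C| + `|C'| in SC.
have D1 : 0 < D + 1 by rewrite ltr_wpDl// addr_ge0.
apply/eqP; rewrite -subr_eq0 -[_ - _]/(S mu) -normr_le0.
apply/ler_addgt0Pr => e e0; rewrite add0r.
have /closure_delta_spanP/(_ _ (divr_gt0 e0 D1))[_ [s _ <-] se] := lip_freeP mu.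
pose nu : lip_free M := \sum_(p <- s) p.1 *: free_delta p.2.
have nuE : lip_free_val nu = \sum_(p <- s) p.1 *: delta p.2.
  by rewrite /nu; elim/big_rec2: _ => // p _ y _ <-.
have -> : S mu = S (mu - nu).
  by rewrite -[mu - nu]addrC -scaleN1r SP Ssum scaler0 add0r.
rewrite (le_trans (SC _))// ltW//.
move: se; rewrite -nuE ltr_pdivlMr//; apply: le_lt_trans.
by rewrite mulrC lip_free_normE ler_wpM2l// lerDl.
Qed.

Definition hat : lip_free M -> lip_free N := projT1 (cid linearization_exists).

Lemma hatP : is_linearization hat.
Proof. exact: projT2 (cid linearization_exists). Qed.

Lemma hat_eq T : is_linearization T -> hat = T.
Proof. exact/linearization_unique/hatP. Qed.

End Linearization.

Definition lip_lin_injective (R : realType) (M : pointedMetricType R) : Prop :=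
  complete_space M /\
  forall N : pointedMetricType R, complete_space N ->
  forall f : lip0 M N, injective f -> injective (hat f).

(* Main.v *)
(* Elements of [lip_free M] are continuous for pointwise convergence on bounded
   sets of [lip0 M R^o], and over a uniformly discrete [M] a bounded function
   has a Lipschitz constant controlled by its supremum. Hence an element [mu] is
   determined by its values on the indicators of points [x <> point]: a
   Lipschitz function is a bounded pointwise limit of its truncations, and a
   bounded one of its restrictions to finite sets. If [hat f mu = 0], then [mu]
   kills all [g \o f]; taking for [g] ever narrower bumps around [f x], the
   [g \o f] converge pointwise to the indicator of [x] by injectivity, and stay
   bounded in Lipschitz norm because they take values in [0, 1]. *)
Require Import Defs.
From mathcomp Require Import all_boot all_order all_algebra.
From mathcomp Require Import reals.
From mathcomp Require Import boolp classical_sets topology normedtype lra.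

Set Implicit Arguments.
Unset Strict Implicit.
Unset Printing Implicit Defensive.

Import Order.TTheory GRing.Theory Num.Theory.
Import numFieldNormedType.Exports.

Local Open Scope classical_set_scope.
Local Open Scope ring_scope.

(** * Truncation of real numbers is 1-Lipschitz *)

Lemma ler_dist_max (R : realFieldType) (a x y : R) :
  `|Num.max a x - Num.max a y| <= `|x - y|.
Proof.
wlog xy : x y / x <= y.
  move=> H; case: (leP x y) => [/H//|/ltW/H].
  by rewrite distrC (distrC y).
have axy : Num.max a x <= Num.max a y by rewrite ge_max !le_max lexx xy orbT.
rewrite distrC (distrC x) !ger0_norm ?subr_ge0//.
by move: axy; case: (leP a x) => ?; case: (leP a y) => ?; lra.
Qed.

Lemma ler_dist_min (R : realFieldType) (a x y : R) :
  `|Num.min a x - Num.min a y| <= `|x - y|.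
Proof.
by have := ler_dist_max (- a) (- x) (- y); rewrite -!oppr_min -!opprD !normrN.
Qed.

Definition clamp (R : realFieldType) (B r : R) : R :=
  Num.max (- B) (Num.min B r).

Lemma clamp_id (R : realFieldType) (B r : R) : `|r| <= B -> clamp B r = r.
Proof.
by rewrite ler_norml /clamp => /andP[Br rB]; rewrite (min_idPr rB) (max_idPr Br).
Qed.

Lemma clamp_le (R : realFieldType) (B r : R) : 0 <= B -> `|clamp B r| <= B.
Proof.
move=> B0; rewrite /clamp ler_norml le_max lexx ge_max ge_min lexx !andbT /=.
by rewrite (le_trans _ B0)// oppr_le0.
Qed.

Lemma ler_dist_clamp (R : realFieldType) (B r s : R) :
  `|clamp B r - clamp B s| <= `|r - s|.
Proof. exact: le_trans (ler_dist_max _ _ _) (ler_dist_min _ _ _). Qed.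

(** * Approximation by finite combinations of evaluations *)

Section LipFree.
Context {R : realType} {M : pointedMetricType R}.
Implicit Types (phi : dual (lip0 M R^o)) (mu : lip_free M) (h k : lip0 M R^o).

Lemma real_lip0 (h : M -> R) (C : R) : 0 <= C -> h point = 0 ->
  (forall x y, `|h x - h y| <= C * mdist x y) ->
  exists2 k : lip0 M R^o, k =1 h & `|k| <= C.
Proof.
move=> C0 h0 hC.
have hP : (h : M -> R^o) \in lip0_pred M R^o.
  by apply/asboolP; split=> //; exists C => x y; rewrite /mdist/= distrC; exact: hC.
by exists (Lip0 hP) => //; exact: lip_norm_le.
Qed.

Lemma lip0_point h : h point = 0.
Proof. by have [] := lip0P h. Qed.

Lemma lip_free_approx mu (e : R) : 0 < e -> exists s : seq (R * M),
  `|mu - \sum_(p <- s) p.1 *: free_delta p.2| < e.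
Proof.
move=> e0; have /closure_delta_spanP/(_ _ e0)[_ [s _ <-] se] := lip_freeP mu.
exists s; rewrite lip_free_normE.
suff -> : lip_free_val (mu - \sum_(p <- s) p.1 *: free_delta p.2) =
  lip_free_val mu - \sum_(p <- s) p.1 *: delta p.2 by [].
rewrite [LHS]/(lip_free_val mu - lip_free_val _); congr (_ - _).
by elim/big_rec2: _ => // p _ y _ <-.
Qed.

Lemma dual_funP phi (a : R) h k : phi (a *: h + k) = a * phi h + phi k.
Proof. exact: linearP. Qed.

Lemma dual_funB phi h k : phi (h - k) = phi h - phi k.
Proof. exact: linearB. Qed.

Lemma lip_free_valP (a : R) mu nu h :
  lip_free_val (a *: mu + nu) h = a * lip_free_val mu h + lip_free_val nu h.
Proof. by []. Qed.

Lemma lip_free_valB mu nu h :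
  lip_free_val (mu - nu) h = lip_free_val mu h - lip_free_val nu h.
Proof. by []. Qed.

Lemma lip_free_sumE (s : seq (R * M)) h :
  lip_free_val (\sum_(p <- s) p.1 *: free_delta p.2) h =
  \sum_(p <- s) p.1 * h p.2.
Proof. by elim/big_rec2: _ => // p x y _ <-. Qed.

(** Approximate [mu] in norm by a finite combination [nu] of evaluations and let [k] agree with [h]
    on the points of [nu]. Then [nu] kills [h - k], so [mu] takes at [h] the value of [mu - nu] at
    [h - k], whose norm is at most [|h| + C]. Quantifying over finite [F] expresses a bounded net
    converging pointwise to [h]. *)
Lemma lip_free_pointwise_closed mu h (C : R) :
  (forall F : seq M, exists k, [/\ lip_free_val mu k = 0, `|k| <= C &
     forall x, x \in F -> k x = h x]) ->
  lip_free_val mu h = 0.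
Proof.
move=> H; apply/eqP; rewrite -normr_le0; apply/ler_addgt0Pr => e e0; rewrite add0r.
have C0 : 0 <= C by have [k [_ kC _]] := H [::]; exact: le_trans kC.
(* The summand 1 only keeps the divisor of [e] positive. *)
have D0 : 0 < `|h| + C + 1 by rewrite ltr_wpDl// addr_ge0.
have [s sP] := lip_free_approx mu (divr_gt0 e0 D0).
have [k [muk kC kh]] := H [seq p.2 | p <- s].
set nu := \sum_(p <- s) _ in sP.
have nuhk : lip_free_val nu h = lip_free_val nu k.
  rewrite !lip_free_sumE; apply: eq_big_seq => p ps; congr (_ * _).
  by rewrite kh//; apply/mapP; exists p.
have -> : lip_free_val mu h = lip_free_val (mu - nu) (h - k).
  by rewrite dual_funB !lip_free_valB muk nuhk sub0r opprK subrK.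
rewrite (le_trans (dual_normP _ _))// -dual_normE -lip_free_normE.
have hkD : `|h - k| <= `|h| + C + 1.
  by rewrite (le_trans (ler_normB _ _))// -addrA lerD// ler_wpDr.
rewrite (le_trans (ler_wpM2l _ hkD))//.
by move: sP; rewrite ltr_pdivlMr// => /ltW.
Qed.

(** Holds by density of the span of the evaluations. *)
Lemma bounded_functional_eq0 (S : lip_free M -> R) (C : R) :
  (forall a mu nu, S (a *: mu + nu) = a * S mu + S nu) ->
  (forall mu, `|S mu| <= C * `|mu|) ->
  (forall x, S (free_delta x) = 0) -> forall mu, S mu = 0.
Proof.
move=> SP SC Sd mu; have S0 : S 0 = 0.
  by have := SP (-1) 0 0; rewrite scaler0 addr0; lra.
have Ssum (s : seq (R * M)) : S (\sum_(p <- s) p.1 *: free_delta p.2) = 0.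
  elim: s => [|p s IH]; first by rewrite big_nil.
  by rewrite big_cons SP IH Sd mulr0 addr0.
apply/eqP; rewrite -normr_le0; apply/ler_addgt0Pr => e e0; rewrite add0r.
have C1 : 0 < `|C| + 1 by rewrite ltr_wpDl.
have [s /ltW] := lip_free_approx mu (divr_gt0 e0 C1).
set nu := \sum_(p <- s) _; rewrite ler_pdivlMr// => se.
have -> : S mu = S (mu - nu).
  by rewrite -[mu - nu]addrC -scaleN1r SP Ssum mulr0 add0r.
rewrite (le_trans (SC _))// (le_trans _ se)// mulrC ler_wpM2l//.
by rewrite (le_trans (ler_norm C))// lerDl.
Qed.

End LipFree.

(** * The linearization is dual to composition with [f] *)

Section Linearization.
Context {R : realType} {M N : pointedMetricType R} (f : lip0 M N).

(** Both sides are bounded and linear in [mu] and agree on evaluations. *)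
Lemma hat_comp (g : lip0 N R^o) (k : lip0 M R^o) (mu : lip_free M) :
  (forall x, k x = g (f x)) ->
  lip_free_val (hat f mu) g = lip_free_val mu k.
Proof.
move=> kE; have [[hl [C hC]] hd] := hatP f.
pose S mu := lip_free_val (hat f mu) g - lip_free_val mu k : R.
apply/eqP; rewrite -subr_eq0; apply/eqP.
apply: (@bounded_functional_eq0 _ _ S (C * `|g| + `|k|)) => [a u v|u|x].
- by rewrite /S hl !lip_free_valP mulrBr opprD addrACA.
- rewrite (le_trans (ler_normB _ _))// mulrDl lerD//.
    rewrite (le_trans (dual_normP _ _))// -dual_normE -lip_free_normE.
    by rewrite mulrAC ler_wpM2r.
  by rewrite (le_trans (dual_normP _ _))// -dual_normE -lip_free_normE mulrC.
- by rewrite /S hd /= /evaluation kE subrr.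
Qed.

End Linearization.

(** * Free spaces over uniformly discrete spaces *)

Section UniformlyDiscrete.
Context {R : realType} {M : pointedMetricType R} (theta : R).
Hypothesis theta0 : 0 < theta.
Hypothesis theta_sep : forall x y : M, x <> y -> theta < mdist x y.

(** Values differ by at most [2 * B], while distinct points are more than [theta] apart. *)
Lemma discrete_bounded_lip0 (h : M -> R) (B : R) : h point = 0 ->
  (forall x, `|h x| <= B) ->
  exists2 k : lip0 M R^o, k =1 h & `|k| <= 2 * B / theta.
Proof.
move=> h0 hB.
have B0 : 0 <= B by exact: le_trans (hB point).
apply: real_lip0 => // [|x y]; first by rewrite divr_ge0 ?mulr_ge0// ltW.
have [->|/eqP xy] := eqVneq x y.
  by rewrite subrr normr0 mulr_ge0 ?divr_ge0 ?mulr_ge0// ?mdist_ge0// ltW.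
rewrite (@le_trans _ _ (2 * B))//.
  by rewrite (le_trans (ler_normB _ _))// mulr_natl mulr2n lerD.
rewrite mulrAC ler_pdivlMr// ler_wpM2l ?mulr_ge0//.
by rewrite ltW// theta_sep.
Qed.

Lemma discrete_lip_free_eq0 (mu : lip_free M) :
  (forall (x : M) (k : lip0 M R^o), x <> point ->
     (forall y, k y = (y == x)%:R) -> lip_free_val mu k = 0) ->
  mu = 0.
Proof.
move=> mu1.
(* Finitely supported functions, by induction on the support: dropping a new point [x] subtracts
   [h x] times its indicator [u]. *)
have mu_fin (h : lip0 M R^o) (F : seq M) (k : lip0 M R^o) :
    (forall x, k x = if x \in F then h x else 0) -> lip_free_val mu k = 0.
  elim: F k => [|x F IH] k kE.
    suff -> : k = 0 by exact: raddf0.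
    by apply/val_inj/funext => y /=; rewrite kE.
  have [xF|xF] := boolP (x \in F).
    by apply: IH => y; rewrite kE inE; case: eqP => // ->; rewrite xF.
  (* The indicator of the base point is not in [lip0], but [h] vanishes there, so nothing has to be
     subtracted. *)
  have [xp|/eqP xp] := eqVneq x point.
    apply: IH => y; rewrite kE inE; case: eqP => // -> /=.
    by rewrite (negbTE xF) xp lip0_point.
  have [|y|u uE _] := @discrete_bounded_lip0 (fun y => (y == x)%:R) 1.
  - by rewrite eq_sym; case: eqP xp.
  - by case: (y == x); rewrite ?normr1 ?normr0.
  have -> : k = h x *: u + (k - h x *: u) by rewrite addrC subrK.
  rewrite dual_funP (mu1 _ _ xp uE) mulr0 add0r; apply: IH => y.
  have -> : (k - h x *: u) y = k y - h x * u y :> R by [].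
  rewrite kE uE inE.
  case: eqP => [->|_]; first by rewrite mulr1 subrr (negbTE xF).
  by rewrite mulr0 subr0.
(* Bounded functions: the restrictions to finite sets share the Lipschitz bound [2 * B / theta]. *)
have mu_bnd (h : lip0 M R^o) (B : R) :
    (forall x, `|h x| <= B) -> lip_free_val mu h = 0.
  move=> hB; apply: (@lip_free_pointwise_closed _ _ _ _ (2 * B / theta)) => F.
  have [|x|k kE kB] := @discrete_bounded_lip0
    (fun x => if x \in F then h x else 0) B.
  - by rewrite lip0_point if_same.
  - by case: ifP => // _; rewrite normr0 (le_trans _ (hB x)).
  by exists k; split=> // [|x xF]; [exact: mu_fin kE|rewrite kE xF].
apply/val_inj/val_inj/funext => h /=.
apply: (@lip_free_pointwise_closed _ _ _ _ `|h|) => F.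
(* Any bound of [|h|] on [F] would do: truncation at [B] then leaves [h] unchanged on [F]. *)
pose B : R := \sum_(x <- F) `|h x|.
have B0 : 0 <= B by exact: sumr_ge0.
have [||x y|k kE kB] := @real_lip0 _ M (fun x => clamp B (h x)) `|h|.
- exact: normr_ge0.
- by rewrite lip0_point clamp_id// normr0.
- exact: le_trans (ler_dist_clamp _ _ _) (lip_normP _ _ _).
exists k; split=> // [|x xF].
  by apply: (mu_bnd _ B) => x; rewrite kE clamp_le.
by rewrite kE clamp_id// /B (big_rem x)//= lerDl sumr_ge0.
Qed.

(** A Cauchy filter contains a ball of radius [theta], which is a single point. *)
Lemma discrete_complete : complete_space M.
Proof.
move=> F FF /cauchyP/(_ theta theta0)[x Fx]; exists x => A /nbhs_singleton Ax.
apply: filterS Fx => y; rewrite ballEmdist/= => xy.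
suff <- : x = y by [].
by apply: contrapT => /theta_sep; rewrite ltNge (ltW xy).
Qed.

Lemma discrete_hat_ker (N : pointedMetricType R) (f : lip0 M N)
    (mu : lip_free M) :
  injective f -> hat f mu = 0 -> mu = 0.
Proof.
move=> finj fmu; apply: discrete_lip_free_eq0 => x h xp hE.
(* The bound does not involve the width of the bump below: it comes from values in [0, 1] and the
   separation of [M]. *)
apply: (@lip_free_pointwise_closed _ _ _ _ (2 * 1 / theta)) => F.
(* A radius around [f x] avoiding the images of the other listed points; it is positive by
   injectivity and finiteness. Including [point] makes the bump vanish at the base point of [N]. *)
have [r r0 rF] : exists2 r : R, 0 < r &
    forall z, z \in point :: F -> z <> x -> r <= mdist (f z) (f x).
  elim: (point :: F) => [|z G [r r0 rG]]; first by exists 1.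
  have [->|/eqP zx] := eqVneq z x.
    by exists r => // y; rewrite inE => /orP[/eqP ->//|]; exact: rG.
  exists (Num.min r (mdist (f z) (f x))).
    by rewrite lt_min r0 mdist_gt0; apply/eqP => /finj.
  move=> y; rewrite inE ge_min => /orP[/eqP -> _|yG yx].
    by rewrite lexx orbT.
  by rewrite rG.
(* Tent of height 1 at [f x], zero from distance [r] on, with Lipschitz constant at most [r^-1]. *)
pose b (y : N) : R := Num.max 0 (1 - mdist y (f x) / r).
have b01 y : 0 <= b y <= 1.
  rewrite /b le_max lexx ge_max ler01 /= lerBlDr lerDl.
  by rewrite divr_ge0 ?mdist_ge0// ltW.
have bF z : z \in point :: F -> b (f z) = (z == x)%:R.
  move=> zF; rewrite /b; have [->|/eqP zx] := eqVneq z x.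
    by rewrite mdistxx mul0r subr0; apply/max_idPr.
  by apply/max_idPl; rewrite subr_le0 ler_pdivlMr// mul1r rF.
have bp : b (f point) = 0.
  by rewrite bF ?mem_head// eq_sym; case: eqP xp.
have [||y z|g gE _] := @real_lip0 _ N b r^-1.
- by rewrite invr_ge0 ltW.
- by have [<- _] := lip0P f.
- have yz : `|mdist y (f x) / r - mdist z (f x) / r| <= r^-1 * mdist y z.
    rewrite -mulrBl normrM mulrC [`|r^-1|]gtr0_norm ?invr_gt0//.
    rewrite ler_wpM2l ?invr_ge0 ?(ltW r0)// ler_norml.
    have := metric_triangle y z (f x); have := metric_triangle z y (f x).
    by rewrite (metric_sym z y) => ? ?; apply/andP; split; lra.
  apply: le_trans yz; rewrite (le_trans (ler_dist_max _ _ _))//.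
  by rewrite opprD opprK addrACA subrr add0r addrC distrC.
(* The composite [b \o f] is built anew as an element of [lip0], since going through the Lipschitz
   constant of [g] would give a bound depending on [r]. *)
have [//|y|k kE kB] := @discrete_bounded_lip0 (fun y => b (f y)) 1.
  by have /andP[? ?] := b01 (f y); rewrite ger0_norm.
exists k; split=> // [|z zF].
  have kg y : k y = g (f y) by rewrite kE gE.
  by rewrite -(hat_comp mu kg) fmu.
by rewrite kE hE bF// inE zF orbT.
Qed.

End UniformlyDiscrete.

Theorem corollary4p14 (R : realType) (M : pointedMetricType R) :
  uniformly_discrete M -> lip_lin_injective M.
Proof.
move=> [theta theta0 sep]; split; first exact: discrete_complete sep.
(* By linearity of [hat f], injectivity reduces to a trivial kernel. *)
move=> N _ f finj mu nu fmunu; apply/eqP; rewrite -subr_eq0; apply/eqP.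
apply: (discrete_hat_ker theta0 sep finj); have [[fl _] _] := hatP f.
by rewrite addrC -scaleN1r fl scaleN1r fmunu addNr.
Qed.
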